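(* Let $H(x)=\dfrac{G(x)}{1-x}\in\mathbf{C}[[x]]$. The following hold: (i) $$H(x)=\sum_{n=0}^\infty\Bigl(\sum_{k=0}^{n}a(k)\Bigr)x^n,$$ so $H(n):=\sum_{k=0}^{n}a(k)$ is the coefficient of $x^n$ in $H(x)$. (ii) For every integer $n\ge0$, $$H(n)=\frac{1-(-1)^{\,n-\lfloor\sqrt n\rfloor^{2}}}{2}.$$
   Context: Let $F(x;z,w)=\sum_{n=0}^{\infty}x^{n}z^{m}w^{j}\in\mathbf{C}[z,w][[x]]$, where in the $n$-th term $m=\lfloor\sqrt n\rfloor$ and $j=n-m^2$. For $a,b\in\mathbf{C}$, $F(x;a,b)\in\mathbf{C}[[x]]$ is obtained by substituting $z=a$, $w=b$ in each coefficient (with the convention $0^0=1$). Define $G(x)=F(x;1,0)-F(x;1,-1)=\sum_{n=0}^\infty a(n)x^n$, so $a(n)$ is the coefficient of $x^n$ in $G(x)$. *)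

(* Defs.v *)
From HB Require Import structures.
From mathcomp Require Import all_boot all_order all_algebra archimedean.
From mathcomp Require Import complex mpoly.
From mathcomp Require Import boolp reals.

Set Implicit Arguments.
Unset Strict Implicit.
Unset Printing Implicit Defensive.

Import Order.TTheory GRing.Theory Num.Theory.
Local Open Scope ring_scope.

(* Formal power series over R, given by their sequence of coefficients;
   [FPS c] stands for \sum_n c(n) x^n. *)
Record fps (R : Type) := FPS { fcoef : nat -> R }.

Notation "\fps_ n E" := (FPS (fun n : nat => E))
  (at level 36, n name, E at level 36, format "\fps_ n  E") : ring_scope.

Lemma fpsP (R : Type) (f g : fps R) : (forall n, fcoef f n = fcoef g n) -> f = g.
Proof. by case: f => f; case: g => g /= fg; congr FPS; apply: funext. Qed.

Definition fps_map (A B : Type) (h : A -> B) (f : fps A) : fps B :=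
  \fps_n h (fcoef f n).

HB.instance Definition _ (R : Type) := gen_eqMixin (fps R).
HB.instance Definition _ (R : Type) := gen_choiceMixin (fps R).

Section FpsZmod.
Variable R : zmodType.
Implicit Types f g h : fps R.

Definition fps_zero : fps R := \fps_n 0.
Definition fps_opp f : fps R := \fps_n (- fcoef f n).
Definition fps_add f g : fps R := \fps_n (fcoef f n + fcoef g n).

Fact fps_addA : associative fps_add.
Proof. by move=> f g h; apply: fpsP => n /=; rewrite addrA. Qed.
Fact fps_addC : commutative fps_add.
Proof. by move=> f g; apply: fpsP => n /=; rewrite addrC. Qed.
Fact fps_add0 : left_id fps_zero fps_add.
Proof. by move=> f; apply: fpsP => n /=; rewrite add0r. Qed.
Fact fps_addN : left_inverse fps_zero fps_opp fps_add.
Proof. by move=> f; apply: fpsP => n /=; rewrite addNr. Qed.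

HB.instance Definition _ :=
  GRing.isZmodule.Build (fps R) fps_addA fps_addC fps_add0 fps_addN.

End FpsZmod.

Section FpsRing.
Variable R : comNzRingType.
Implicit Types f g h : fps R.

Definition fps_one : fps R := \fps_n (n == 0)%:R.
Definition fps_mul f g : fps R :=
  \fps_n (\sum_(i < n.+1) fcoef f i * fcoef g (n - i)%N).
Definition fpsX : fps R := \fps_n (n == 1)%:R.

Let trunc N f : {poly R} := \poly_(i < N) fcoef f i.

Let coef_mul N n f g (p q : {poly R}) : (n < N)%N ->
  (forall i, (i < N)%N -> p`_i = fcoef f i) ->
  (forall i, (i < N)%N -> q`_i = fcoef g i) ->
  (p * q)`_n = fcoef (fps_mul f g) n.
Proof.
move=> nN pf qg; rewrite coefM /=; apply: eq_bigr => i _.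
rewrite pf ?qg //; first exact: leq_ltn_trans (leq_subr _ _) nN.
exact: leq_ltn_trans (leq_ord i) nN.
Qed.

Let coef_trunc N f i : (i < N)%N -> (trunc N f)`_i = fcoef f i.
Proof. by move=> iN; rewrite coef_poly iN. Qed.

Fact fps_mulA : associative fps_mul.
Proof.
move=> f g h; apply: fpsP => n; pose T := trunc n.+1.
rewrite -(@coef_mul n.+1 n f (fps_mul g h) (T f) (T g * T h)) //.
- rewrite mulrA (@coef_mul n.+1 n (fps_mul f g) h) // => i iN.
    by rewrite (@coef_mul n.+1 i f g) // => *; exact: coef_trunc.
  exact: coef_trunc.
- by move=> *; exact: coef_trunc.
- by move=> i iN; rewrite (@coef_mul n.+1 i g h) // => *; exact: coef_trunc.
Qed.

Fact fps_mulC : commutative fps_mul.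
Proof.
move=> f g; apply: fpsP => n; pose T := trunc n.+1.
rewrite -(@coef_mul n.+1 n f g (T f) (T g)) // => [|i|i]; try exact: coef_trunc.
by rewrite mulrC (@coef_mul n.+1 n g f) // => i; exact: coef_trunc.
Qed.

Fact fps_mul1 : left_id fps_one fps_mul.
Proof.
move=> f; apply: fpsP => n /=; rewrite big_ord_recl /= mul1r subn0.
by rewrite big1 ?addr0 // => i _; rewrite mul0r.
Qed.

Fact fps_mulDl : left_distributive fps_mul (@fps_add R).
Proof.
move=> f g h; apply: fpsP => n /=; rewrite -big_split /=.
by apply: eq_bigr => i _; rewrite mulrDl.
Qed.

Fact fps_one_neq0 : fps_one != 0.
Proof.
apply/eqP => /(congr1 (fun f => fcoef f 0)) /= /eqP.
by rewrite oner_eq0.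
Qed.

HB.instance Definition _ := GRing.Zmodule_isComNzRing.Build (fps R)
  fps_mulA fps_mulC fps_mul1 fps_mulDl fps_one_neq0.

Lemma fcoef0 n : fcoef (0 : fps R) n = 0. Proof. by []. Qed.
Lemma fcoef1 n : fcoef (1 : fps R) n = (n == 0)%:R. Proof. by []. Qed.
Lemma fcoefX n : fcoef fpsX n = (n == 1)%:R. Proof. by []. Qed.
Lemma fcoefN f n : fcoef (- f) n = - fcoef f n. Proof. by []. Qed.
Lemma fcoefD f g n : fcoef (f + g) n = fcoef f n + fcoef g n. Proof. by []. Qed.
Lemma fcoefB f g n : fcoef (f - g) n = fcoef f n - fcoef g n. Proof. by []. Qed.
Lemma fcoefM f g n :
  fcoef (f * g) n = \sum_(i < n.+1) fcoef f i * fcoef g (n - i)%N.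
Proof. by []. Qed.

End FpsRing.

Section FpsUnitRing.
Variable R : comUnitRingType.
Implicit Types f g : fps R.

(* A series is invertible iff its constant coefficient is; the coefficients b
   of the inverse of f are then determined by the recurrence
   \sum_(i <= n) b_i f_(n-i) = (n == 0).  [fps_inv_prefix f n] lists the first n
   of them. *)
Fixpoint fps_inv_prefix f (n : nat) : seq R :=
  if n is m.+1 then
    let s := fps_inv_prefix f m in
    rcons s ((fcoef f 0)^-1 *
             ((m == 0)%:R - \sum_(i < m) s`_i * fcoef f (m - i)%N))
  else [::].

Definition fps_unit : {pred fps R} := [pred f | fcoef f 0 \is a GRing.unit].

Definition fps_inv f : fps R :=
  if f \in fps_unit then \fps_n (fps_inv_prefix f n.+1)`_n else f.

Let size_inv_prefix f n : size (fps_inv_prefix f n) = n.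
Proof. by elim: n => //= n IHn; rewrite size_rcons IHn. Qed.

Let nth_inv_prefix f n i : (i < n)%N ->
  (fps_inv_prefix f n)`_i = (fps_inv_prefix f i.+1)`_i.
Proof.
elim: n => // n IHn; rewrite ltnS leq_eqVlt => /predU1P[-> //|lt_in].
by rewrite -IHn //= nth_rcons size_inv_prefix lt_in.
Qed.

Fact fps_mulVf : {in fps_unit, left_inverse 1 fps_inv *%R}.
Proof.
move=> f Uf; apply: fpsP => n.
rewrite fcoefM fcoef1 /fps_inv Uf big_ord_recr /= subnn.
rewrite nth_rcons size_inv_prefix ltnn eqxx mulrC mulVKr //.
rewrite addrC -[RHS]addr0 -addrA; congr (_ + _).
apply/eqP; rewrite addrC subr_eq0; apply/eqP/eq_bigr => i _.
by rewrite (nth_inv_prefix f (ltn_ord i)).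
Qed.

Fact fps_unitPl f g : g * f = 1 -> f \in fps_unit.
Proof.
move/(congr1 (fun h => fcoef h 0)); rewrite fcoefM fcoef1 big_ord1 /= => gf1.
by apply/unitrPr; exists (fcoef g 0); rewrite mulrC.
Qed.

Fact fps_inv_out : {in [predC fps_unit], fps_inv =1 id}.
Proof. by move=> f; rewrite inE /= /fps_inv => /negPf ->. Qed.

HB.instance Definition _ := GRing.ComNzRing_hasMulInverse.Build (fps R)
  fps_mulVf fps_unitPl fps_inv_out.

Lemma unit_fpsE f : (f \is a GRing.unit) = (fcoef f 0 \is a GRing.unit).
Proof. by []. Qed.

Lemma unit_1subX : 1 - fpsX R \is a GRing.unit.
Proof. by rewrite unit_fpsE fcoefB fcoef1 fcoefX subr0 unitr1. Qed.

End FpsUnitRing.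

Section Series.
Variable R : realType.

Definition floor_sqrt (n : nat) : nat := Num.truncn (Num.sqrt (n%:R : R)).

(* The indeterminates z and w are 'X_0 and 'X_1. *)
Definition Fser : fps {mpoly R[i][2]} :=
  \fps_n ('X_(ord0 : 'I_2) ^+ floor_sqrt n *
          'X_(ord_max : 'I_2) ^+ (n - floor_sqrt n ^ 2)%N).

Definition Fsubst (a b : R[i]) : fps R[i] :=
  fps_map (meval (tnth [tuple a; b])) Fser.

Definition Gser : fps R[i] := Fsubst 1 0 - Fsubst 1 (-1).

Definition a_coef (n : nat) : R[i] := fcoef Gser n.

Definition Hser : fps R[i] := Gser / (1 - fpsX R[i]).

Definition Hsum (n : nat) : R[i] := \sum_(0 <= k < n.+1) a_coef k.

End Series.

(* Main.v *)
Require Import Defs.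
From mathcomp Require Import all_boot all_order all_algebra.
From mathcomp Require Import complex reals.
From mathcomp Require Import archimedean mpoly zify ring.
Import GRing.Theory Num.Theory.
Local Open Scope ring_scope.

(** Dividing a power series by [1 - x] sums its coefficients
    ([fps_div_1subX]), so the coefficients of [H] are the partial sums of [a].

    For their closed form, write [n = m ^ 2 + j] with [m] the integer square
    root of [n], so that [0 <= j <= 2 * m].  Substituting [z = 1] erases [m],
    hence [a(n) = 0 ^ j - (-1) ^ j] ([a_coefE]): on each block
    [m ^ 2 <= n < m.+1 ^ 2] the coefficients read [0, 1, -1, 1, -1, ...].  A
    block has the odd length [2 * m + 1], so its leading [0] is followed by [m]
    cancelling pairs: every block sums to [0], and within a block the partial
    sums alternate [0, 1, 0, 1, ..., 0].  This is [(1 - (-1) ^ j) / 2].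

    The proof of [HsumE] is an induction on [n]; passing from [n] to [n.+1]
    either stays in the block ([j] grows by one) or leaves it ([j = 2 * m] is
    reset to [0]), which is the dichotomy of [floor_sqrtS]. *)

(** Equivalently, multiplying the series of partial sums by [1 - x] telescopes
    it back to [f]. *)
Lemma fps_div_1subX (R : comUnitRingType) (f : fps R) :
  f / (1 - fpsX R) = \fps_n (\sum_(0 <= k < n.+1) fcoef f k).
Proof.
apply: (canLR (mulrK (unit_1subX R))); apply: fpsP => -[|n].
  by rewrite fcoefM big_ord1 /= big_nat1 subr0 mulr1.
rewrite fcoefM big_ord_recr big_ord_recr /= subnn subSnn big1 /= => [|i _].
  by rewrite sub0r subr0 add0r mulr1 mulrN1 (big_nat_recr n.+1) //= addKr.
have := ltn_ord i => lt_in.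
have [-> ->] : (n.+1 - i == 0)%N = false /\ (n.+1 - i == 1)%N = false by lia.
by rewrite subr0 mulr0.
Qed.

Lemma floor_sqrt_bounds (R : realType) n :
  (floor_sqrt R n ^ 2 <= n < (floor_sqrt R n).+1 ^ 2)%N.
Proof.
have /andP[lb ub] := truncn_itv (sqrtr_ge0 (n%:R : R)).
rewrite -(ler_nat R) -(ltr_nat R) !natrX -(@sqr_sqrtr R n%:R) ?ler0n //.
by rewrite lerXn2r ?ltrXn2r ?nnegrE ?sqrtr_ge0 ?ler0n.
Qed.

Lemma floor_sqrt_unique (R : realType) n m :
  (m ^ 2 <= n < m.+1 ^ 2)%N -> floor_sqrt R n = m.
Proof.
have /andP[lb ub] := floor_sqrt_bounds R n => /andP[lbm ubm].
have := leq_ltn_trans lb ubm; have := leq_ltn_trans lbm ub.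
by rewrite !ltn_sqr !ltnS => le1 le2; apply/eqP; rewrite eqn_leq le2.
Qed.

Lemma floor_sqrtS (R : realType) n (m := floor_sqrt R n) :
  (floor_sqrt R n.+1 = m)
  \/ (floor_sqrt R n.+1 = m.+1 /\ n.+1 = m.+1 ^ 2 :> nat)%N.
Proof.
have := floor_sqrt_bounds R n; rewrite -/m => /andP[lb].
rewrite leq_eqVlt => /predU1P[eqn|ltn]; [right | left].
  by split=> //; apply: floor_sqrt_unique; rewrite eqn leqnn ltn_sqr /=.
by apply: floor_sqrt_unique; rewrite ltn (leq_trans lb) /=.
Qed.

Lemma fcoef_Fsubst (R : realType) (a b : R[i]) n :
  fcoef (Fsubst a b) n =
    a ^+ floor_sqrt R n * b ^+ (n - floor_sqrt R n ^ 2)%N.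
Proof. by rewrite /= mevalM !rmorphXn /= !mevalXU. Qed.

Lemma a_coefE (R : realType) n (j := (n - floor_sqrt R n ^ 2)%N) :
  a_coef R n = 0 ^+ j - (-1) ^+ j.
Proof. by rewrite /a_coef fcoefB !fcoef_Fsubst !expr1n !mul1r. Qed.

Lemma HsumE (R : realType) n :
  Hsum R n = (1 - (-1) ^+ (n - floor_sqrt R n ^ 2)%N) / 2.
Proof.
elim: n => [|n IHn].
  by rewrite /Hsum big_nat1 a_coefE sub0n !expr0 !subrr mul0r.
rewrite /Hsum big_nat_recr //= -/(Hsum R n) IHn a_coefE.
have /andP[lb _] := floor_sqrt_bounds R n.
have [->|[-> nE]] := floor_sqrtS R n.
  by rewrite subSn // expr0n exprS /=; field.
(* The block that ends at [n] has length [2 * m + 1], so [j] is even there. *)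
have -> : (n - floor_sqrt R n ^ 2 = (floor_sqrt R n) * 2)%N by lia.
by rewrite -nE subnn exprM sqrr_sign !expr0 !subrr mul0r addr0.
Qed.

Theorem theorem7p1 (R : realType) :
  (Hser R = \fps_n (\sum_(0 <= k < n.+1) a_coef R k)
   /\ forall n : nat, fcoef (Hser R) n = Hsum R n)
  /\ (forall n : nat,
        Hsum R n = (1 - (- 1) ^+ (n - floor_sqrt R n ^ 2)%N) / 2).
Proof.
have HserE : Hser R = \fps_n (\sum_(0 <= k < n.+1) a_coef R k).
  exact: fps_div_1subX.
by split; [split=> // n; rewrite HserE | exact: HsumE].
Qed.
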